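(* Let $(\epsilon_d)_{d}$ be a sequence, indexed by positive integers $d$, with $0 < \epsilon_d \le 1$ and $\epsilon_d \to 0$ as $d \to \infty$. Given $\epsilon > 0$ there exists $d_0 = d_0(\epsilon, \{\epsilon_d\})$ such that if $d \ge d_0$, then, setting $\tau = \epsilon_d \frac{\log d}{d}\, n$, with high probability (as $n \to \infty$ with $d$ fixed) any induced subgraph of $\mathcal{G}_{n,d}$ all of whose connected components have size at most $\tau$ has size at most $$(2+\epsilon)\,\frac{\log d}{d}\, n .$$
   Context: The size of a (sub)graph is its number of vertices. $\mathcal{G}_{n,d}$ denotes the random $d$-regular multigraph on $n$ labelled vertices given by the configuration model: $nd$ is assumed even, each of the $n$ vertices emits $d$ distinct half-edges, the $nd$ half-edges are paired uniformly at random (there are $(nd-1)!!$ pairings), and each pair is glued into an edge; loops and multiple edges are allowed. A sequence of events $E_n$ occurs with high probability if $\mathbb{P}[E_n] \to 1$ as $n \to \infty$. $\log$ is the natural logarithm. *)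

(* Defs.v *)
From HB Require Import structures.
From mathcomp Require Import all_boot all_order all_algebra.
From mathcomp Require Import all_classical all_reals all_analysis.

Set Implicit Arguments.
Unset Strict Implicit.
Unset Printing Implicit Defensive.

Import Order.TTheory GRing.Theory Num.Theory.
Import numFieldNormedType.Exports.

Local Open Scope classical_set_scope.
Local Open Scope ring_scope.

Definition pairings (T : finType) : {set {set {set T}}} :=
  [set P : {set {set T}} |
    finset.partition P [set: T] && [forall B in P, #|B| == 2%N]].

(* Vertex [v : 'I_n] emits the half-edges [(v, i)], [i : 'I_d]. *)
Definition half_edge (n d : nat) : finType := ('I_n * 'I_d)%type.

(* The multigraph glued from the pairing [P] has the blocks of [P] as edges
   (so parallel edges are distinct blocks), and the ends of the edge [B] are the
   vertices emitting its two half-edges; [B] is a loop at [u] when it joins [u]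
   and [u]. *)
Definition joins (n d : nat) (B : {set half_edge n d}) (u v : 'I_n) : bool :=
  [set h.1 | h in B]%SET == [set u; v]%SET.

Definition config_adj (n d : nat) (P : {set {set half_edge n d}}) : rel 'I_n :=
  fun u v => [exists B in P, joins B u v].

Definition induced_rel (V : finType) (e : rel V) (S : {set V}) : rel V :=
  fun u v => [&& u \in S, v \in S & e u v].

(* Vertex sets of the connected components of the subgraph induced on [S]; [e]
   is meant to be symmetric.  Loops and edge multiplicities play no role here. *)
Definition components (V : finType) (e : rel V) (S : {set V}) : {set {set V}} :=
  equivalence_partition (connect (induced_rel e S)) S.

(* Probability of [E] under the uniform distribution on pairings of the
   half-edges; the quotient is meaningful only for [n * d] even, since otherwise
   there are no pairings. *)
Definition config_prob (R : realType) (n d : nat)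
    (E : pred {set {set half_edge n d}}) : R :=
  #|[set P in pairings (half_edge n d) | E P]%SET|%:R
    / #|pairings (half_edge n d)|%:R.

(* For odd [d], [n] tends to infinity through even values only. *)
Definition config_whp (R : realType) (d : nat)
    (E : forall n : nat, pred {set {set half_edge n d}}) : Prop :=
  config_prob R (E n) @[n --> within [set n | ~~ odd (n * d)] \oo] --> (1 : R).

(* Main.v *)
Require Import Defs.
From mathcomp Require Import all_classical all_reals all_analysis.
From mathcomp Require Import all_boot all_order all_algebra.
From mathcomp Require Import zify ring lra.

(** The proof is a first-moment argument over coarse colourings.  Write
    [L = ln d / d].  Because [eps_ d] tends to [0], for large [d] the components
    have at most [t <= (eps / 8) L n] vertices; the constant [eps / 8] no longer
    depends on [d], and this is what keeps the number of colours below bounded.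

    Suppose that an induced subgraph with such components has more than
    [(2 + eps) L n] vertices.  Keep exactly [k] of them, with [k] just above
    [(2 + eps) L n], and merge the pieces of components that remain into groups
    of at most [2 t] vertices ([colouring_of_small_components]).  Laying the
    pieces end to end and cutting every [t] vertices gives [M + 1] groups, where
    [M] depends on [eps] alone.  No edge joins two different groups, although
    at least [k (k - 2 t)] ordered pairs of kept vertices lie in different
    groups: almost all pairs do.

    For one fixed colouring, such a configuration is unlikely.  Exposing the
    pairing one half-edge at a time, always from a coloured half-edge, shows that
    the probability that no edge joins two different colours is at most
    [exp (- d k (k - 2 t) / (2 (n + k)))] ([card_pairings_clash_free_le]), about
    [exp (- (1 + 3 eps / 8) k ln d)].  There are at most ['C(n, k) (M + 2) ^ k]
    colourings, that is about [exp (k (ln d + O(1)))], so for large [d] the union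
    bound is at most [exp (- k)] ([energy_beats_entropy]), and [k] grows with
    [n]. *)

Set Implicit Arguments.
Unset Strict Implicit.
Unset Printing Implicit Defensive.

Import Order.TTheory GRing.Theory Num.Theory.
Import numFieldNormedType.Exports.

(** * Counting pairings *)

Section Pairings.
Variable T : finType.
Implicit Types (G : pred {set T}) (X : {set T}) (P Q : {set {set T}}).

(** Pairings of the half-edges that are still unpaired, all of whose pairs pass
    the test [G].  Keeping [X] and [G] as parameters is what lets pairs be
    exposed one at a time. *)
Definition pairings_on G X : {set {set {set T}}} :=
  [set P : {set {set T}} |
    partition P X && [forall B in P, (#|B| == 2) && G B]].

Lemma pairings_onP G X P :
  reflect [/\ partition P X, forall B, B \in P -> #|B| = 2
            & forall B, B \in P -> G B] (P \in pairings_on G X).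
Proof.
rewrite inE; apply: (iffP andP) => [[pP /forall_inP allP]|[pP P2 GP]].
  by split=> // B /allP /andP[/eqP].
by split=> //; apply/forall_inP => B BP; rewrite P2 // eqxx GP.
Qed.

Lemma pairings_on0 G : pairings_on G set0 = [set set0].
Proof.
apply/setP => P; rewrite in_set1; apply/pairings_onP/eqP => [[]|->].
  by rewrite partition_set0 => /eqP.
by rewrite partition_set0; split=> // B; rewrite in_set0.
Qed.

Lemma pairing_partner G X P x : x \in X -> P \in pairings_on G X ->
  #|[set y in X :\ x | [set x; y] \in P]| = 1.
Proof.
move=> xX /pairings_onP[pP P2 _]; case/and3P: (pP) => /eqP covP tP _.
have xP : x \in cover P by rewrite covP.
have BP := pblock_mem xP; have xB : x \in pblock P x by rewrite mem_pblock.
have /eqP/cards2P[a [b [ab Bab]]] := P2 _ BP.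
have [y yx By] : exists2 y, y != x & pblock P x = [set x; y].
  move: xB; rewrite Bab in_set2 => /orP[]/eqP->; first by exists b; rewrite // eq_sym.
  by exists a; rewrite // setUC.
have yX : y \in X by rewrite -covP; apply/bigcupP; exists (pblock P x); rewrite // By set22.
suff -> : [set y in X :\ x | [set x; y] \in P] = [set y] by rewrite cards1.
apply/setP => z; rewrite !inE; apply/idP/eqP => [/andP[/andP[zx _] zP]|->].
  have : z \in pblock P x by rewrite (def_pblock tP zP) ?set21 // set22.
  by rewrite By in_set2 (negPf zx) => /eqP.
by rewrite yx yX -By.
Qed.

Lemma card_pairings_with G X x y : x \in X -> y \in X :\ x ->
  #|[set P in pairings_on G X | [set x; y] \in P]| =
  if G [set x; y] then #|pairings_on G (X :\: [set x; y])| else 0.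
Proof.
rewrite !inE => xX /andP[yx yX].
have xyX : [set x; y] \subset X by rewrite subUset !sub1set xX.
have xy0 : [set x; y] != set0 by apply/set0Pn; exists x; rewrite set21.
case: ifP => Gxy; last first.
  apply: eq_card0 => P; rewrite inE; apply/negP => /andP[/pairings_onP[_ _ GP] /GP].
  by rewrite Gxy.
set A := [set P in _ | _].
have injA : {in A &, injective (fun P => P :\ [set x; y])}.
  move=> P Q; rewrite !in_set => /andP[_ Pxy] /andP[_ Qxy] PQ.
  by rewrite -(setD1K Pxy) PQ setD1K.
rewrite -(card_in_imset injA); apply: eq_card => Q.
apply/imsetP/pairings_onP => [[P]|[pQ Q2 GQ]].
  rewrite in_set => /andP[/pairings_onP[pP P2 GP] Pxy] ->.
  split; first exact: partitionD1.
    by move=> B /setD1P[_ /P2].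
  by move=> B /setD1P[_ /GP].
have dQ : [disjoint [set x; y] & X :\: [set x; y]].
  by rewrite disjoint_sym disjoints_subset; apply/subsetP => z /setDP[_]; rewrite !inE.
have nQ : [set x; y] \notin Q.
  apply/negP => xyQ; case/and3P: pQ => /eqP covQ _ _.
  have /setDP[_] : x \in X :\: [set x; y].
    by rewrite -covQ; apply/bigcupP; exists [set x; y]; rewrite // set21.
  by rewrite set21.
exists ([set x; y] |: Q); last by rewrite setU1K.
rewrite in_set setU11 andbT; apply/pairings_onP; split.
- have := partitionU1 pQ xy0 dQ; rewrite setDE setUIr setUCr setIT.
  by move/setUidPr: xyX => ->.
- move=> B /setU1P[->|/Q2 //]; by rewrite cards2 eq_sym yx.
- by move=> B /setU1P[->|/GQ].
Qed.

(** Exposing the partner [y] of [x]: removing the pair [{x, y}] leaves a pairing of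
    the other elements, and every such pairing arises once. *)
Lemma card_pairings_rec G X x : x \in X ->
  #|pairings_on G X| =
  \sum_(y in X :\ x | G [set x; y]) #|pairings_on G (X :\: [set x; y])|.
Proof.
move=> xX; rewrite -sum1_card.
under eq_bigr => P PX do rewrite -(pairing_partner xX PX) -sum1_card.
under eq_bigr => P _ do (under eq_bigl => y do rewrite in_set).
rewrite (exchange_big_dep (mem (X :\ x))) /=; last by move=> P y _ /andP[].
rewrite big_mkcondr /=; apply: eq_bigr => y yX.
rewrite -(card_pairings_with G xX yX) -sum1_card; apply: eq_bigl => P.
by rewrite in_set yX.
Qed.

(** This is [(N - 1)!!] for even [N] and [0] for odd [N]. *)
Fixpoint num_pairings (N : nat) : nat :=
  if N is N'.+1 then N' * (if N' is N''.+1 then num_pairings N'' else 0) else 1.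

Lemma card_pairings X : #|pairings_on predT X| = num_pairings #|X|.
Proof.
have [N] := ubnP #|X|; elim: N X => // N IH X ltXN.
have [->|[x xX]] := set_0Vmem X; first by rewrite pairings_on0 cards1 cards0.
rewrite (card_pairings_rec _ xX); move: ltXN; rewrite (cardsD1 x X) xX add1n.
have cDxy y : y \in X :\ x -> #|X :\: [set x; y]| = #|X :\ x|.-1.
  by move=> yX; rewrite -setDDl [in RHS](cardsD1 y) yX.
case cX: #|X :\ x| cDxy => [|m] cDxy ltmN.
  by rewrite big_pred0 // => y; rewrite (cards0_eq cX) in_set0.
under eq_bigl do rewrite andbT.
under eq_bigr => y yX do (rewrite IH cDxy //; last by lia).
by rewrite sum_nat_const cX.
Qed.

Lemma num_pairings_gt0 N : ~~ odd N -> 0 < num_pairings N.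
Proof.
have [m] := ubnP N; elim: m N => // m IH [|[|N]] //= ltN.
by rewrite negbK => /negPf oN; rewrite mulnC muln_gt0 andbT IH ?oN //; lia.
Qed.
End Pairings.

Section Cross.
Variables (T : finType) (r : rel T).
Definition rel_deg (X : {set T}) x := #|[set y in X | r x y]|.
(** The number of ordered related pairs inside [X]. *)
Definition rel_size (X : {set T}) := \sum_(x in X) rel_deg X x.

Lemma rel_degD1 X x z : rel_deg X x <= rel_deg (X :\ z) x + r x z.
Proof.
rewrite /rel_deg (cardsD1 z) addnC leq_add //; last by rewrite inE; case: (r x z); rewrite ?andbF ?leq_b1.
by apply: subset_leq_card; apply/subsetP => y; rewrite !inE andbA.
Qed.

Hypothesis r_sym : symmetric r.

Lemma rel_sizeD1 X z : rel_size X <= rel_size (X :\ z) + 2 * rel_deg X z.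
Proof.
have [zX|zX] := boolP (z \in X); last first.
  suff -> : X :\ z = X by rewrite leq_addr.
  by apply/setDidPl; rewrite disjoint_sym disjoints1.
rewrite /rel_size (big_setD1 z zX) /=.
rewrite addnC mul2n -addnn addnA leq_add2r.
apply: (@leq_trans (\sum_(x in X :\ z) (rel_deg (X :\ z) x + r x z))).
  by apply: leq_sum => x _; exact: rel_degD1.
rewrite big_split leq_add2l /= /rel_deg -sum1_card big_mkcond [X in _ <= X]big_mkcond.
apply: leq_sum => x _; rewrite !inE r_sym.
by case: (x \in X); case: (r z x); case: (x == z).
Qed.

Lemma rel_sizeD2 X x y :
  rel_size X <= rel_size (X :\: [set x; y]) + 2 * (rel_deg X x + rel_deg X y).
Proof.
have degS : rel_deg (X :\ x) y <= rel_deg X y.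
  by apply: subset_leq_card; apply/subsetP => z; rewrite !inE => /andP[/andP[_ ->]].
have := rel_sizeD1 X x; have := rel_sizeD1 (X :\ x) y; rewrite setDDl; lia.
Qed.
End Cross.

Section Colour.
Variables (T : finType) (K : eqType) (c : T -> option K).
(** The colour [None] stands for vertices outside the chosen set, which clash with
    nothing. *)
Definition clash : rel T := fun x y => [&& c x : bool, c y : bool & c x != c y].
Definition clash_free : pred {set T} :=
  fun B => [forall x in B, forall y in B, ~~ clash x y].

Lemma clash_sym : symmetric clash.
Proof. by move=> x y; rewrite /clash andbCA eq_sym. Qed.

Lemma clash_free2 x y : clash_free [set x; y] = ~~ clash x y.
Proof.
apply/forall_inP/idP => [H|nxy z].
  by move/forall_inP: (H x (set21 _ _)) => /(_ y (set22 _ _)).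
have nn u : ~~ clash u u by rewrite /clash eqxx !andbF.
rewrite in_set2 => /orP[]/eqP->; apply/forall_inP => w; rewrite in_set2 => /orP[]/eqP-> //.
by rewrite clash_sym.
Qed.
End Colour.

(** * Grouping small components into few colours *)

Section Grouping.
Variables (T : finType) (f : T -> nat) (S : {set T}) (t : nat).
Hypothesis fiber_le : forall x, x \in S -> #|[set y in S | f y == f x]| <= t.
(** If the fibres of [f] are laid end to end in increasing order, the fibre of [x]
    starts at position [offset x]. *)
Definition offset x := #|[set y in S | f y < f x]|.

(** A group consists of the fibres that start in one window of length [t].  They
    occupy consecutive positions, and the last one sticks out of the window by at
    most [t], whence the bound [2 * t]. *)
Lemma card_offset_block (j : nat) : 0 < t ->
  #|[set x in S | offset x %/ t == j]| <= 2 * t.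
Proof.
move=> t0; set A := [set x in S | _].
have inA y : (y \in A) = (y \in S) && (offset y %/ t == j) by rewrite inE.
have [->|[x0 x0A]] := set_0Vmem A; first by rewrite cards0.
case: (arg_minnP f x0A) => a aA amin; case: (arg_maxnP f x0A) => b bA bmax.
have {}aA : a \in A by []. have {}bA : b \in A by [].
move: (aA) (bA); rewrite !inA => /andP[aS /eqP aj] /andP[bS /eqP bj].
(* [a] and [b] lie in the first and the last fibre of the group *)
have AU : A :|: [set y in S | f y < f a] \subset [set y in S | f y < f b] :|: [set y in S | f y == f b].
  apply/subsetP => y; rewrite in_setU => /orP[yA|].
    have yS : y \in S by move: yA; rewrite inA => /andP[].
    by have := bmax _ yA; rewrite !inE yS /=; case: ltngtP.
  rewrite !inE => /andP[yS ya]; have := amin _ bA.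
  by rewrite yS /= => /(leq_trans ya) ->.
have dA : A :&: [set y in S | f y < f a] = set0.
  apply/setP => y; rewrite in_setI in_set0; apply/negP => /andP[yA]; rewrite inE => /andP[_ ya].
  by have := amin y yA; rewrite leqNgt ya.
have := leq_trans (subset_leq_card AU) (leq_card_setU _ _).
rewrite cardsU dA cards0 subn0 => H.
have := fiber_le bS; have := ltn_ceil (offset b) t0; have := leq_divM (offset a) t.
rewrite aj bj /offset; move: H; set p := #|_|; set q := #|_|; set v := #|_|; set w := #|_|.
lia.
Qed.
End Grouping.

Lemma subset_of_card (T : finType) (S : {set T}) k : k <= #|S| ->
  exists2 S' : {set T}, S' \subset S & #|S'| = k.
Proof.
move/card_geqP => [s [us ss sS]]; exists [set x in s].
  by apply/subsetP => x; rewrite inE => /sS.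
by rewrite cardsE (card_uniqP us).
Qed.

(** The colour of a vertex is the index of the group of its component, cut down to
    [S'].  The vertices of [S'] that share a colour number at most [2 * t], so
    each vertex of [S'] clashes with at least [k - 2 * t] others. *)
Lemma colouring_of_small_components (V : finType) (e : rel V) (S : {set V})
    (t k M : nat) :
  symmetric e -> 0 < t -> (forall C, C \in components e S -> #|C| <= t) ->
  k <= #|S| -> k %/ t <= M ->
  exists (S' : {set V}) (c : {ffun V -> option 'I_M.+1}),
    [/\ #|S'| = k, c \in pffun_on None S' predT,
        k * (k - 2 * t) <= rel_size (clash c) [set: V]
      & forall u v, e u v -> ~~ clash c u v].
Proof.
move=> esym t0 small leS leM.
have [S' S'S cS'] := subset_of_card leS.
have csym : connect_sym (induced_rel e S).
  apply: sym_connect_sym => u v; rewrite /induced_rel esym.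
  by rewrite andbCA.
have eqv : {in S & &, equivalence_rel (connect (induced_rel e S))}.
  move=> x y z _ _ _; split; first exact: connect0.
  by move=> xy; exact: same_connect.
have /and3P[/eqP covC tC _] := equivalence_partitionP eqv.
pose f x : nat := enum_rank (pblock (components e S) x).
have fE x y : f x = f y -> pblock (components e S) x = pblock (components e S) y.
  by move=> /val_inj/enum_rank_inj.
have fib x : x \in S' -> #|[set y in S' | f y == f x]| <= t.
  move=> xS'; have xS := subsetP S'S x xS'.
  apply: leq_trans (small _ (pblock_mem (_ : x \in cover _))); last by rewrite covC.
  apply: subset_leq_card; apply/subsetP => y; rewrite inE => /andP[yS' /eqP/fE <-].
  by rewrite mem_pblock covC (subsetP S'S).
have offM x : offset f S' x %/ t < M.+1.
  rewrite ltnS (leq_trans _ leM) // leq_div2r // -cS'.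
  by apply: subset_leq_card; apply/subsetP => y; rewrite inE => /andP[].
pose c := [ffun x => if x \in S' then Some (inord (offset f S' x %/ t) : 'I_M.+1) else None].
have cP x : (c x : bool) = (x \in S') by rewrite ffunE; case: ifP.
have cE x y : x \in S' -> y \in S' ->
    (c x == c y) = (offset f S' x %/ t == offset f S' y %/ t).
  move=> xS' yS'; rewrite !ffunE xS' yS'; apply/eqP/eqP => [[]|-> //].
  by move/(congr1 val); rewrite /= !inordK.
exists S', c; split=> //.
- apply/pffun_onP; split=> //; apply/subsetP => x; rewrite inE -cP.
  by case: (c x).
- apply: (@leq_trans (\sum_(x in S') rel_deg (clash c) [set: V] x)); last first.
    by rewrite /rel_size big_mkcond [X in _ <= X]big_mkcond; apply: leq_sum => x _; rewrite inE; case: ifP.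
  rewrite -{1}cS' -sum_nat_const; apply: leq_sum => x xS'.
  rewrite leq_subLR.
  have := card_offset_block fib (offset f S' x %/ t) t0.
  set A := [set y in S' | _] => cA.
  have /subset_leq_card : S' \subset A :|: [set y in [set: V] | clash c x y].
    apply/subsetP => y yS'; rewrite !inE yS' /clash !cP xS' yS' /= cE //.
    by rewrite eq_sym orbN.
  by rewrite cS' => /leq_trans; apply; rewrite (leq_trans (leq_card_setU _ _)) // leq_add2r.
- move=> u v euv; apply/negP => /and3P[]; rewrite !cP => uS' vS'.
  rewrite cE //; apply/negP; rewrite negbK.
  suff fuv : f u = f v by rewrite /offset fuv.
  have [uS vS] := (subsetP S'S _ uS', subsetP S'S _ vS').
  suff -> : f u = f v by [].
  rewrite /f; congr (nat_of_ord (enum_rank _)); apply: same_pblock => //.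
  rewrite pblock_equivalence_partition //; apply: connect1.
  by rewrite /induced_rel uS vS esym.
Qed.

(** * The union bound over colourings *)

Lemma leq_card_bigcup (I T : finType) (p : pred I) (F : I -> {set T}) :
  #|\bigcup_(i | p i) F i| <= \sum_(i | p i) #|F i|.
Proof.
elim/big_rec2: _ => [|i m A _ IH]; first by rewrite cards0.
by rewrite (leq_trans (leq_card_setU _ _)) // leq_add2l.
Qed.

Section HalfEdges.
Variables (n d : nat).

Lemma card_config_pairings :
  #|pairings (half_edge n d)| = num_pairings (n * d).
Proof.
have -> : pairings (half_edge n d) = pairings_on predT [set: half_edge n d].
  apply/setP => P; rewrite !inE; congr (_ && _).
  by apply: eq_forallb => B; rewrite andbT.
by rewrite card_pairings cardsT card_prod !card_ord.
Qed.

Lemma card_half_edges (p : pred 'I_n) :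
  #|[set h : half_edge n d | p h.1]| = #|[set v | p v]| * d.
Proof.
rewrite -[X in _ * X]card_ord -[#|'I_d|]cardsT -cardsX.
by apply: eq_card => -[v i]; rewrite !inE andbT.
Qed.

Lemma rel_size_half_edges (r : rel 'I_n) :
  rel_size (fun h h' : half_edge n d => r h.1 h'.1) [set: half_edge n d]
    = d ^ 2 * rel_size r [set: 'I_n].
Proof.
rewrite /rel_size; under eq_bigl do rewrite in_setT.
under [in RHS]eq_bigl do rewrite in_setT.
have degE (h : half_edge n d) :
    rel_deg (fun h h' : half_edge n d => r h.1 h'.1) [set: half_edge n d] h
  = rel_deg r [set: 'I_n] h.1 * d.
  rewrite /rel_deg -card_half_edges.
  by apply: eq_card => h'; rewrite !inE.
under eq_bigr => h _ do rewrite degE.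
rewrite -(pair_big predT predT (fun v _ => rel_deg r [set: 'I_n] v * d)) /=.
under eq_bigr do rewrite sum_nat_const card_ord.
by rewrite -big_distrr /= -big_distrl /= mulnC -mulnA mulnn mulnC.
Qed.

(** Since [S] is only required to have at least [k] vertices, while the colourings
    live on exactly [k] of them, the sum runs over one cardinality instead of all
    cardinalities from [k] to [n]. *)
Lemma card_small_component_pairings (t k M : nat) : 0 < t -> k %/ t <= M ->
  #|[set P in pairings (half_edge n d) | [exists S : {set 'I_n},
      (k <= #|S|) && [forall C in components (config_adj P) S, #|C| <= t]]]| <=
  \sum_(S : {set 'I_n} | #|S| == k)
   \sum_(c in pffun_on (None : option 'I_M.+1) S predT |
      k * (k - 2 * t) <= rel_size (clash c) [set: 'I_n])
     #|pairings_on (clash_free (fun h : half_edge n d => c h.1)) [set: half_edge n d]|.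
Proof.
move=> t0 leM.
pose U := \bigcup_(S : {set 'I_n} | #|S| == k)
   \bigcup_(c in pffun_on (None : option 'I_M.+1) S predT |
      k * (k - 2 * t) <= rel_size (clash c) [set: 'I_n])
     pairings_on (clash_free (fun h : half_edge n d => c h.1)) [set: half_edge n d].
apply: (@leq_trans #|U|); last first.
  apply: (leq_trans (leq_card_bigcup _ _)); apply: leq_sum => S _.
  exact: leq_card_bigcup.
apply: subset_leq_card; apply/subsetP => P.
rewrite inE => /andP[Pp /existsP[S /andP[kS /forall_inP small]]].
have esym : symmetric (config_adj P).
  by move=> u v; apply: eq_existsb => B; rewrite /joins setUC.
have [S' [c [cS' cp cR nc]]] := colouring_of_small_components esym t0 small kS leM.
apply/bigcupP; exists S'; first by rewrite cS'.
apply/bigcupP; exists c; first by rewrite cp.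
move: Pp; rewrite inE => /andP[pP /forall_inP P2].
apply/pairings_onP; split=> // B BP; first by apply/eqP/P2.
have /cards2P[h [h' [_ BE]]] := P2 _ BP.
rewrite BE clash_free2; apply: (nc h.1 h'.1).
apply/exists_inP; exists B => //; rewrite /joins BE.
by rewrite imsetU !imset_set1.
Qed.
End HalfEdges.

(** * Pairings without clashes are rare *)

Local Open Scope ring_scope.

(** The step in the exposure of the partner of a coloured half-edge [x]: among the
    candidates, [u] are uncoloured, [a] share the colour of [x] and [s] clash
    with it.  The expected gain is at most [1] although a partner of the same colour
    uses up two half-edges at once (the term with [2 * (s / D)]); this is why [D]
    exceeds the number of half-edges by the number of coloured ones.  With
    [y = s / D] and [expR y <= 1 / (1 - y)], the claim reduces to [y * D <= s]. *)
Lemma exposure_step_le (R : realType) (u a s D : R) :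
  0 <= u -> 0 <= a -> 0 <= s -> 0 < D -> (u + a + s) + a + s <= D ->
  u * expR (s / D) + a * expR (2 * (s / D)) <= u + a + s.
Proof.
move=> u0 a0 s0 D0 leD; set y := s / D.
have yD : y * D = s by rewrite /y divfK // gt_eqF.
have y0 : 0 <= y by rewrite divr_ge0 // ltW.
have y1 : y < 1 by rewrite ltr_pdivrMr // mul1r; lra.
have z0 : 0 < 1 - y by lra.
have ez : expR y <= (1 - y)^-1.
  rewrite -[y in expR y]opprK expRN lef_pV2 ?posrE ?expR_gt0 //.
  exact: (le_trans _ (expR_ge1Dx (- y))).
have -> : expR (2 * y) = expR y ^+ 2 by rewrite expRM_natl.
have ez2 : expR y ^+ 2 <= (1 - y)^-1 ^+ 2 by rewrite lerXn2r ?nnegrE ?expR_ge0 ?invr_ge0 // ltW.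
have := lerD (ler_wpM2l u0 ez) (ler_wpM2l a0 ez2).
move/le_trans; apply.
have -> : u * (1 - y)^-1 + a * (1 - y)^-1 ^+ 2 = (u * (1 - y) + a) / (1 - y) ^+ 2.
  by field; rewrite gt_eqF.
rewrite ler_pdivrMr ?exprn_gt0 //.
have : y * (u + a + s + a + s) <= s by rewrite -[X in _ <= X]yD ler_wpM2l.
nra.
Qed.

Section ClashFree.
Variables (R : realType) (T : finType) (K : eqType) (c : T -> option K).
Let D : R := (#|T| + #|[set x | c x]%SET|)%:R.

(** Induction on [X], exposing the partner of a coloured [x] that clashes with
    some element.  If the partner is uncoloured, the ordered clashing pairs drop by
    at most twice the degree [s] of [x]; if it has the colour of [x], both ends have
    degree [s] and the drop is at most [4 * s].  The potential thus loses a factor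
    [expR (s / D)] or [expR (2 * (s / D))], and [exposure_step_le] pays for it on
    average over the partners. *)
Lemma card_pairings_clash_free_le (X : {set T}) :
  #|pairings_on (clash_free c) X|%:R <=
  (num_pairings #|X|)%:R * expR (- ((rel_size (clash c) X)%:R / (2 * D))).
Proof.
have [N] := ubnP #|X|; elim: N X => // N IH X ltXN.
have [size0|] := posnP (rel_size (clash c) X).
  rewrite size0 mul0r oppr0 expR0 mulr1 ler_nat -card_pairings.
  apply: subset_leq_card; apply/fintype.subsetP => P /pairings_onP[pP P2 _].
  by apply/pairings_onP.
rewrite lt0n sum_nat_eq0 negb_forall => /existsP[x].
rewrite negb_imply => /andP[xX sx0].
have cx : c x.
  apply: contraNT sx0 => ncx; rewrite cards_eq0; apply/eqP/setP => y.
  by rewrite !inE /clash (negPf ncx) andbF.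
set O := rel_size _ _; set s := rel_deg (clash c) X x.
rewrite (card_pairings_rec _ xX) natr_sum.
set u := #|[set y in X :\ x | ~~ c y]%SET|.
set a := #|[set y in X :\ x | c y == c x]%SET|.
have cX : #|X :\ x| = (u + a + s)%N.
  rewrite /u /a /s /rel_deg -!sum1_card big_mkcond [X in (X + _ + _)%N]big_mkcond.
  rewrite [X in (_ + X + _)%N]big_mkcond [X in (_ + _ + X)%N]big_mkcond -!big_split /=.
  apply: eq_bigr => y _; rewrite !inE /clash [c y == _]eq_sym.
  have [->|_] := eqVneq y x; first by rewrite eqxx /= !andbF.
  case: (y \in X) => //=; rewrite cx /=.
  by have [<-|_] := eqVneq (c x) (c y); [rewrite cx | case: (c y)].
have aS : (a + s <= #|[set x | c x]%SET|)%N.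
  rewrite /a /s /rel_deg -!sum1_card big_mkcond [X in (_ + X <= _)%N]big_mkcond.
  rewrite [X in (_ <= X)%N]big_mkcond -!big_split /=.
  apply: leq_sum => y _; rewrite !inE /clash [c y == _]eq_sym cx /=.
  have [<-|_] := eqVneq (c x) (c y); first by rewrite cx !andbF addn0; case: ifP.
  by rewrite !andbF /= andbT; case: (c y); rewrite ?andbF //=; case: ifP.
have [X0|X1] := posnP #|X :\ x|.
  rewrite big_pred0; first by rewrite mulr_ge0 ?expR_ge0.
  by move=> y; rewrite (cards0_eq X0) finset.in_set0.
have D0 : 0 < D.
  rewrite ltr0n addn_gt0; apply/orP; left; apply/card_gt0P; by exists x.
have cXm : num_pairings #|X| = (#|X :\ x| * num_pairings #|X :\ x|.-1)%N.
  by rewrite (cardsD1 x X) xX add1n; case: #|X :\ x| X1.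
set m := num_pairings _.-1 in cXm; set w := expR (- (O%:R / (2 * D))).
pose h y := if c y then expR (2 * (s%:R / D)) else expR (s%:R / D).
apply: (@le_trans _ _ (\sum_(y in X :\ x | clash_free c [set x; y]%SET) m%:R * w * h y)).
  apply: ler_sum => y /andP[yX]; rewrite clash_free2 /clash cx /= negb_and negbK => nc.
  have cDxy : #|X :\: [set x; y]%SET| = #|X :\ x|.-1.
    by rewrite -finset.setDDl [in RHS](cardsD1 y) yX.
  have cD : (#|X :\ x|.-1 < N)%N.
    by move: ltXN; rewrite (cardsD1 x X) xX; move: X1; clear; lia.
  apply: le_trans (IH _ _) _; rewrite cDxy // -/m.
  rewrite -mulrA ler_wpM2l // /w /h -[if _ then _ else _](_ : expR (if c y then 2 * (s%:R / D) else s%:R / D) = _); last by case: ifP.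
  rewrite -expRD ler_expR.
  have := rel_sizeD2 (clash_sym c) X x y; rewrite -/s -/O.
  set O' := rel_size _ _.
  have sy : rel_deg (clash c) X y = if c y then s else 0%N.
    case: ifP nc => cy /=.
      move=> /eqP cxy; rewrite /s /rel_deg; apply: eq_card => z.
      by rewrite !inE /clash cxy.
    move=> _; apply/eqP; rewrite cards_eq0; apply/eqP/setP => z.
    by rewrite !inE /clash cy andbF.
  rewrite sy -(ler_nat R) natrD natrM natrD => H.
  have E : forall r : R, r / (2 * D) = (r / 2) / D by move=> r; rewrite invfM mulrA.
  rewrite !E; case: (c y) H => /= H; rewrite ?mulrA -!mulNr -mulrDl ler_pM2r ?invr_gt0 //; lra.
rewrite -mulr_sumr cXm natrM -[_ * _ * w]mulrA mulrC.
rewrite ler_wpM2r ?mulr_ge0 ?expR_ge0 //.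
rewrite (bigID (fun y => ~~ c y)) /=.
have -> : \sum_(y | (y \in X :\ x) && clash_free c [set x; y]%SET && ~~ c y) h y = u%:R * expR (s%:R / D).
  rewrite /u -sum1_card natr_sum mulr_suml; apply: eq_big => y.
    by rewrite clash_free2 !inE /clash; case: (c y) => [?|]; rewrite /= ?andbF ?andbT.
  by case/andP => _ ncy; rewrite mul1r /h (negPf ncy).
have -> : \sum_(y | (y \in X :\ x) && clash_free c [set x; y]%SET && ~~ ~~ c y) h y = a%:R * expR (2 * (s%:R / D)).
  rewrite /a -sum1_card natr_sum mulr_suml; apply: eq_big => y.
    rewrite clash_free2 !inE /clash cx negbK /= negb_and negbK [c y == _]eq_sym.
    by have [<-|_] := eqVneq (c x) (c y); rewrite ?cx ?orbT ?andbT ?orbF //; case: (c y); rewrite ?andbF ?orbF.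
  by case/andP => _; rewrite negbK mul1r /h => ->.
rewrite cX !natrD; apply: exposure_step_le => //.
have Xle : (#|X :\ x| <= #|T|)%N by exact: max_card.
rewrite -!natrD ler_nat -addnA -cX leq_add //.
Qed.
End ClashFree.

(** * The probability of a large set with small components *)

(** Induction on [k], using [(1 + 1 / k) ^ k <= e]. *)
Lemma factorial_lower_bound (R : realType) (k : nat) :
  k%:R ^+ k <= (k`!)%:R * expR k%:R :> R.
Proof.
elim: k => [|k IH]; first by rewrite expr0 expR0 mulr1.
have [->|k0] := posnP k; first by rewrite expr1 !mul1r ltW // (lt_le_trans _ (expR_ge1Dx _)) // ltrDl.
have kR : 0 < k%:R :> R by rewrite ltr0n.
have -> : k.+1%:R ^+ k.+1 = k.+1%:R * ((1 + k%:R^-1) ^+ k * k%:R ^+ k) :> R.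
  by rewrite exprS -exprMn mulrDl mul1r mulVf ?gt_eqF // natr1.
have H : (1 + k%:R^-1) ^+ k <= expR 1 :> R.
  have -> : expR 1 = expR (k%:R^-1) ^+ k :> R by rewrite -expRM_natl mulfV ?gt_eqF.
  by rewrite lerXn2r ?nnegrE ?expR_ge0 ?expR_ge1Dx // addr_ge0 // invr_ge0 ltW.
rewrite factS natrM -mulrA ler_wpM2l // -natr1 expRD mulrA [_ * expR 1]mulrC.
by rewrite ler_pM // ?exprn_ge0 ?addr_ge0 ?invr_ge0 // ltW.
Qed.

Lemma binomial_upper_bound (R : realType) (n k : nat) : (0 < k)%N ->
  'C(n, k)%:R <= (n%:R / k%:R * expR 1) ^+ k :> R.
Proof.
move=> k0; have kR : 0 < k%:R :> R by rewrite ltr0n.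
rewrite !exprMn exprVn -expRM_natl mulr1 mulrAC ler_pdivlMr ?exprn_gt0 //.
have fk : 0 < (k`!)%:R :> R by rewrite ltr0n fact_gt0.
rewrite -(ler_pM2r fk) mulrAC -natrM bin_ffact.
have -> : n%:R ^+ k * expR k%:R * (k`!)%:R = n%:R ^+ k * ((k`!)%:R * expR k%:R) :> R by ring.
apply: ler_pM => //; [|exact: factorial_lower_bound].
rewrite -natrX ler_nat ffact_prod -[in X in (_ <= X)%N](card_ord k) -prod_nat_const.
by apply: leq_prod => i _; exact: leq_subr.
Qed.

(** The union bound, with ['C(n, k) <= (e n / k) ^ k].  Each vertex of [S] has
    [M + 2] choices, the [M + 1] colours and [None]: a colouring supported in [S]
    may leave vertices of [S] uncoloured, and having fewer coloured vertices only
    improves its bound. *)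
Lemma config_small_component_bound (R : realType) (n d k t M : nat) :
  ~~ odd (n * d) -> (0 < d)%N -> (0 < k)%N -> (0 < t)%N -> (k %/ t <= M)%N ->
  config_prob R (fun P : {set {set half_edge n d}} => [exists S : {set 'I_n},
      (k <= #|S|)%N && [forall C in components (config_adj P) S, #|C| <= t]%N]) <=
  (n%:R / k%:R * expR 1 * M.+2%:R *
     expR (- (d%:R * (k - 2 * t)%:R / (2 * (n + k)%:R)))) ^+ k :> R.
Proof.
move=> nd d0 k0 t0 leM.
have hE : #|half_edge n d| = (n * d)%N by rewrite card_prod !card_ord.
have P0 : 0 < (num_pairings (n * d))%:R :> R by rewrite ltr0n num_pairings_gt0.
rewrite /config_prob card_config_pairings ler_pdivrMr //.
set w := expR (- _).
have w1 (c : {ffun 'I_n -> option 'I_M.+1}) (S : {set 'I_n}) : #|S| = k ->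
    c \in pffun_on None S predT ->
    (k * (k - 2 * t) <= rel_size (clash c) [set: 'I_n]%SET)%N ->
    #|pairings_on (clash_free (fun h : half_edge n d => c h.1)) [set: half_edge n d]%SET|%:R
      <= (num_pairings (n * d))%:R * w ^+ k.
  move=> cS cp cR.
  apply: le_trans (card_pairings_clash_free_le R _ _) _.
  rewrite cardsT hE ler_wpM2l //.
  have ck : (#|[set v | c v]%SET| <= k)%N.
    rewrite -cS; apply: subset_leq_card; case/pffun_onP: cp => cS' _.
    apply/fintype.subsetP => v; rewrite inE => cv; apply: (fintype.subsetP cS').
    by rewrite inE; case: (c v) cv.
  rewrite /w -expRM_natl ler_expR mulrN lerN2.
  rewrite (card_half_edges d (fun v => c v)).
  rewrite -[rel_size _ _]/(rel_size (fun h h' : half_edge n d => clash c h.1 h'.1) _).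
  rewrite rel_size_half_edges.
  set m := #|_| in ck *; set r := rel_size _ _ in cR *.
  have dR : 0 < d%:R :> R by rewrite ltr0n.
  have nk : 0 < (n + k)%:R :> R by rewrite ltr0n addn_gt0 k0 orbT.
  have nm : (0 < n + m)%N.
    have := max_card (mem S); rewrite cS card_ord => kn.
    by rewrite addn_gt0 (leq_trans k0 kn).
  have nmR : 0 < (n + m)%:R :> R by rewrite ltr0n.
  have -> : (d ^ 2 * r)%:R / (2 * (n * d + m * d)%:R) = d%:R * r%:R / (2 * (n + m)%:R) :> R.
    rewrite -mulnDl !natrM; move: ((n + m)%:R : R) nmR => q q0; field; rewrite !gt_eqF //.
  rewrite mulrA mulrCA -[leRHS]mulrA -[leLHS]mulrA ler_pM2l // ler_pM //.
  - by rewrite -natrM ler_nat.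
  by rewrite lef_pV2 ?posrE ?mulr_gt0 // ler_pM2l // ler_nat leq_add2l.
apply: le_trans (_ : (\sum_(S : {set 'I_n} | #|S| == k)
   \sum_(c in pffun_on (None : option 'I_M.+1) S predT) (num_pairings (n * d))%:R * w ^+ k) <= _).
  have := card_small_component_pairings n d t0 leM.
  rewrite -(ler_nat R) => /le_trans; apply; rewrite natr_sum.
  apply: ler_sum => S /eqP cS; rewrite natr_sum big_mkcondr /=.
  apply: ler_sum => c cp; case: ifP => cR; first exact: w1 cp cR.
  by rewrite mulr_ge0 ?exprn_ge0 ?expR_ge0.
have -> : \sum_(S : {set 'I_n} | #|S| == k)
   \sum_(c in pffun_on (None : option 'I_M.+1) S predT) (num_pairings (n * d))%:R * w ^+ k
   = 'C(n, k)%:R * (M.+2%:R ^+ k * ((num_pairings (n * d))%:R * w ^+ k)) :> R.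
  rewrite -[n in 'C(n, _)]card_ord -card_draws -sum1_card natr_sum mulr_suml.
  apply: eq_big => [S|S /eqP cS]; first by rewrite inE.
  rewrite big_const iter_addr_0 card_pffun_on cS.
  by rewrite mul1r card_option card_ord -[LHS]mulr_natl natrX.
set q := n%:R / k%:R * expR 1.
rewrite [leRHS](_ : _ = q ^+ k * (M.+2%:R ^+ k * ((num_pairings (n * d))%:R * w ^+ k))).
  by rewrite ler_wpM2r ?binomial_upper_bound // !mulr_ge0 ?exprn_ge0 ?expR_ge0.
by rewrite -/w !exprMn; ring.
Qed.

Lemma config_prob_dist1 (R : realType) (n d : nat)
    (E F : pred {set {set half_edge n d}}) :
  ~~ odd (n * d) -> (forall P, E P || F P) ->
  `|1 - config_prob R E| <= config_prob R F.
Proof.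
move=> nd EF.
have P0 : 0 < #|pairings (half_edge n d)|%:R :> R.
  by rewrite card_config_pairings ltr0n num_pairings_gt0.
have cE : (#|[set P in pairings (half_edge n d) | E P]%SET| <= #|pairings (half_edge n d)|)%N.
  by apply: subset_leq_card; apply/fintype.subsetP => P; rewrite inE => /andP[].
rewrite /config_prob -[X in X - _](divff (lt0r_neq0 P0)) -mulrBl normrM.
rewrite [X in _ * X]ger0_norm ?invr_ge0 ?(ltW P0) // ler_pM2r ?invr_gt0 //.
rewrite ger0_norm ?subr_ge0 ?ler_nat // lerBlDr -natrD ler_nat addnC.
apply: leq_trans (leq_card_setU _ _); apply: subset_leq_card.
by apply/fintype.subsetP => P PP; rewrite !inE in PP *; rewrite PP /= EF.
Qed.

(** * Choice of parameters *)

(** With [x = L n], choosing a vertex costs [n / k <= d = expR a] and the missing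
    edges gain about [d k / (2 n) >= (1 + eps / 2) a] in the exponent.  Of this
    excess [eps / 2], the correction [2 t] uses [eps / 8], the factor [n / (n + k)]
    uses another [eps / 8] since [k / n] is of order [a / d <= 4 / a], and the
    remaining [eps / 4] times [a] absorbs the constants and leaves [- 1]. *)
Lemma energy_beats_entropy (R : realType) (eps a d n k t m : R) :
  0 < eps -> d = expR a -> 1 <= a -> 4 * (3 + eps) * (8 + 2 * eps) / eps <= a ->
  0 < m -> 4 * (2 + ln m) / eps <= a -> 0 < n -> 1 <= a / d * n ->
  (2 + eps) * (a / d * n) < k -> k <= (2 + eps) * (a / d * n) + 1 ->
  t <= eps / 8 * (a / d * n) ->
  n / k * expR 1 * m * expR (- (d * (k - 2 * t) / (2 * (n + k)))) <= expR (- 1).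
Proof.
move=> e0 dE a1 a2 m0 a3 n0; set x := a / d * n => x1 kx kx1 tx.
have d0 : 0 < d by rewrite dE expR_gt0.
have a0 : 0 < a by lra.
have x0 : 0 < x by rewrite (lt_le_trans _ x1).
have k0 : 0 < k by rewrite (lt_trans _ kx) // mulr_gt0 //; lra.
have xd : x * d = a * n by rewrite /x mulrAC divfK // gt_eqF.
clearbody x.
(* [d = (expR (a / 2)) ^ 2 >= (1 + a / 2) ^ 2]: [d] dominates [a] *)
have da : a ^+ 2 <= 4 * d.
  have -> : d = expR (a / 2) ^+ 2 by rewrite dE -expRM_natl; congr expR; field.
  have h := expR_ge1Dx (a / 2); have : 0 <= a / 2 by lra.
  by nra.
have nk : n / k <= expR a.
  rewrite -dE ler_pdivrMr // (le_trans _ (ler_wpM2l (ltW d0) (ltW kx))) //.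
  have -> : d * ((2 + eps) * x) = (2 + eps) * (a * n) by rewrite -xd; ring.
  have an : n <= a * n by rewrite ler_peMl // ltW.
  by rewrite (le_trans an) // ler_peMl ?mulr_ge0 ?ltW //; lra.
have main : (1 + eps / 4) * a <= d * (k - 2 * t) / (2 * (n + k)).
  rewrite ler_pdivlMr; last by nra.
  (* [k <= (3 + eps) x] is at most an [eps / (8 + 2 eps)] fraction of [n] *)
  have xn : (3 + eps) * x * (8 + 2 * eps) <= eps * n.
    pose C := (3 + eps) * (8 + 2 * eps).
    have C4 : 4 * C <= a * eps by rewrite -ler_pdivrMr // /C mulrA.
    have -> : (3 + eps) * x * (8 + 2 * eps) = C * x by rewrite /C; ring.
    move: C C4 => C C4.
    rewrite -(ler_pM2r d0) -mulrA xd.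
    have an : 0 <= a * n by rewrite mulr_ge0 ?ltW.
    have en : 0 <= eps * n by rewrite mulr_ge0 ?ltW.
    have := ler_wpM2l en da; have := ler_wpM2r an C4; rewrite expr2; nra.
  have kle : k <= (3 + eps) * x by lra.
  have dk : (2 + 3 * eps / 4) * (a * n) <= d * (k - 2 * t).
    have -> : (2 + 3 * eps / 4) * (a * n) = d * ((2 + 3 * eps / 4) * x) by rewrite -xd; ring.
    by rewrite ler_wpM2l //; lra.
  apply: le_trans dk.
  have -> : (1 + eps / 4) * a * (2 * (n + k)) = 2 * a * ((1 + eps / 4) * (n + k)) by ring.
  have -> : (2 + 3 * eps / 4) * (a * n) = 2 * a * ((1 + 3 * eps / 8) * n) by field.
  rewrite ler_wpM2l ?mulr_ge0 //; first by lra.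
  have h : (1 + eps / 4) * k <= (1 + eps / 4) * ((3 + eps) * x) by rewrite ler_wpM2l //; lra.
  lra.
rewrite -[m in _ * m * _](@lnK _ m) ?posrE //.
apply: (@le_trans _ _ (expR a * expR 1 * expR (ln m) * expR (- (d * (k - 2 * t) / (2 * (n + k)))))).
  by rewrite !ler_wpM2r ?expR_ge0.
rewrite -!expRD ler_expR.
have : 4 * (2 + ln m) <= a * eps by rewrite -ler_pdivrMr.
by move: main; rewrite mulrDl; lra.
Qed.

Local Open Scope classical_set_scope.

Theorem theorem1 (R : realType) (eps_ : nat -> R)
    (eps_bounds : forall d : nat, (0 < d)%N -> 0 < eps_ d <= 1)
    (eps_cvg : eps_ d @[d --> \oo] --> (0 : R))
    (eps : R) (eps_gt0 : 0 < eps) :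
  exists d0 : nat, forall d : nat, (0 < d)%N -> (d0 <= d)%N ->
    config_whp R (fun (n : nat) (P : {set {set half_edge n d}}) =>
      [forall S : {set 'I_n},
        [forall C in components (config_adj P) S,
          #|C|%:R <= eps_ d * (ln d%:R / d%:R) * n%:R :> R]
        ==> (#|S|%:R <= (2 + eps) * (ln d%:R / d%:R) * n%:R :> R)]).
Proof.
(* [k / t] is at most [(3 + eps) L n] over half of [(eps / 8) L n] *)
pose M := Num.truncn (16 * (3 + eps) / eps).
pose A := Num.max 1 (Num.max (4 * (3 + eps) * (8 + 2 * eps) / eps)
                             (4 * (2 + ln M.+2%:R) / eps)).
have eps8 : 0 < eps / 8 by lra.
have [d1 _ d1P] := cvgr0_norm_le _ eps_cvg _ eps8.
exists (maxn d1 (Num.truncn (expR A)).+1) => d d_gt0.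
rewrite geq_max => /andP[/d1P /= epsd dA].
have {}epsd : eps_ d <= eps / 8 := le_trans (ler_norm _) epsd.
have dR : 0 < d%:R :> R by rewrite ltr0n.
set a := ln d%:R.
have aE : d%:R = expR a :> R by rewrite lnK ?posrE.
have : A <= a.
  by rewrite -ler_expR -aE (le_trans (ltW (truncnS_gt _))) // ler_nat.
rewrite !ge_max => /and3P[a1 a2 a3].
have L0 : 0 < a / d%:R by rewrite divr_gt0 // (lt_le_trans _ a1).
set L := a / d%:R in L0 *.
apply/cvgrPdist_le => e e_gt0; rewrite near_withinE.
exists (Num.truncn (Num.max 1 (Num.max (16 / eps) e^-1) / L)).+1 => // n /= Nn nd.
set x := L * n%:R.
have : Num.max 1 (Num.max (16 / eps) e^-1) <= x.
  by rewrite /x [L * _]mulrC -ler_pdivrMr // (le_trans (ltW (truncnS_gt _))) // ler_nat.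
rewrite !ge_max => /and3P[x1 x2 x3].
have x_gt0 : 0 < x by rewrite (lt_le_trans _ x1).
have n_gt0 : 0 < n%:R :> R by move: x_gt0; rewrite /x pmulr_rgt0.
pose t := Num.truncn (eps / 8 * x).
pose k := (Num.truncn ((2 + eps) * x)).+1.
have /andP[t1 t2] : t%:R <= eps / 8 * x < t.+1%:R by rewrite truncn_itv // mulr_ge0 ?ltW.
have /andP[k1 k2] : (Num.truncn ((2 + eps) * x))%:R <= (2 + eps) * x < k%:R.
  by rewrite truncn_itv // mulr_ge0 ?ltW //; lra.
have epsx : 16 <= eps * x by rewrite mulrC -ler_pdivrMr.
have kle : k%:R <= (2 + eps) * x + 1 :> R by rewrite (_ : k%:R = (Num.truncn ((2 + eps) * x))%:R + 1) ?lerD2r // natr1.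
have t_ge : eps / 16 * x <= t%:R by move: t2; rewrite (_ : t.+1%:R = t%:R + 1) ?natr1 // => t2; lra.
have t_gt0 : (0 < t)%N.
  by rewrite -(ltr0n R) (lt_le_trans _ t_ge) // mulr_gt0 //; lra.
have kt : (k %/ t <= M)%N.
  rewrite truncn_ge_nat; last by rewrite divr_ge0 ?ltW //; lra.
  rewrite ler_pdivlMr //.
  have := leq_divM k t; rewrite -(ler_nat R) natrM => h.
  have h2 : (k %/ t)%:R * (eps / 16 * x) <= (k %/ t)%:R * t%:R by rewrite ler_wpM2l.
  rewrite -(ler_pM2r x_gt0); lra.
pose F (P : {set {set half_edge n d}}) := [exists S : {set 'I_n},
  (k <= #|S|)%N && [forall C in components (config_adj P) S, #|C| <= t]%N].
apply: (@le_trans _ _ (config_prob R F)).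
  apply: config_prob_dist1 => // P; rewrite -implyNb; apply/implyP.
  rewrite negb_forall => /existsP[S]; rewrite negb_imply -ltNge => /andP[/forall_inP small big].
  apply/existsP; exists S; apply/andP; split.
    by rewrite ltnNge -(ler_nat R) -ltNge (le_lt_trans k1) // /x mulrA.
  apply/forall_inP => C CP; rewrite truncn_ge_nat; last by rewrite mulr_ge0 ?ltW.
  by rewrite (le_trans (small C CP)) // -mulrA ler_wpM2r // ltW.
apply: (le_trans (config_small_component_bound R nd d_gt0 _ t_gt0 kt)) => //.
apply: (@le_trans _ _ (expR (- 1) ^+ k)).
  rewrite lerXn2r ?nnegrE ?expR_ge0 // ?mulr_ge0 ?invr_ge0 ?expR_ge0 //.
  have kt2 : k%:R - 2 * t%:R <= (k - 2 * t)%:R :> R.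
    by rewrite lerBlDr -natrM -natrD ler_nat addnC -leq_subLR.
  apply: le_trans (energy_beats_entropy eps_gt0 aE a1 a2 _ a3 n_gt0 x1 k2 kle t1) => //.
  rewrite ler_wpM2l ?mulr_ge0 ?invr_ge0 ?expR_ge0 // ler_expR lerN2.
  have nk_gt0 : 0 < n%:R + k%:R :> R by rewrite addr_gt0 ?(ltr0n R k).
  by rewrite natrD ler_pM2r ?invr_gt0 ?mulr_gt0 // ler_wpM2l // ltW.
rewrite -expRM_natl mulrN1 expRN invf_ple ?posrE ?expR_gt0 //.
by rewrite (le_trans x3) // (le_trans _ (expR_ge1Dx _)) //; lra.
Qed.
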